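(* Let $\mathcal{K}$ be one of the following: the complex field $\mathbf{C}$, the semifield $\mathbf{R}_+$ of nonnegative real numbers with the usual arithmetic, or the max-times semifield $\mathbf{R}_+(\max)$. Let $V\subseteq\mathcal{K}^n$ be a nontrivial closed subspace, and let $\mathcal{S}$ be a quasinilpotent (or nilpotent) semigroup (under composition) of linear operators $\mathcal{K}^n\to\mathcal{K}^n$ such that $AV\subseteq V$ for all $A\in\mathcal{S}$. Then $\mathcal{S}$ has an eigenvector $v\in V$; that is, there is a nonzero $v\in V$ such that for each $A\in\mathcal{S}$ there is $\lambda_A\in\mathcal{K}$ with $Av=\lambda_A v$.
   Context: $\mathbf{R}_+(\max)$ is the set of nonnegative real numbers with addition $a\oplus b:=\max(a,b)$ and the usual multiplication. $\mathcal{K}^n$ is the $n$-fold product $\mathcal{K}\times\cdots\times\mathcal{K}$ with componentwise addition and scalar multiplication over $\mathcal{K}$ (so for $\mathcal{K}=\mathbf{R}_+(\max)$ addition of vectors is the componentwise maximum). Linear operators on $\mathcal{K}^n$ are the maps given by $n\times n$ matrices over $\mathcal{K}$, with matrix multiplication using the operations of $\mathcal{K}$. Subspaces of $\mathcal{K}^n$: for $\mathcal{K}=\mathbf{C}$ they are the usual linear subspaces of $\mathbf{C}^n$; for $\mathcal{K}=\mathbf{R}_+$ they are the convex cones in $\mathbf{R}_+^n$ (subsets containing $0$ and closed under addition and multiplication by nonnegative scalars); for $\mathcal{K}=\mathbf{R}_+(\max)$ they are the max cones, i.e. subsets of $\mathbf{R}_+^n$ containing $0$ and closed under componentwise maximum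 of vectors and multiplication by nonnegative scalars. A subspace is nontrivial if it contains a nonzero vector, and closed if it is closed in the usual Euclidean topology. For a semigroup $\mathcal{S}$ and an integer $k\ge 1$, $\mathcal{S}^{(k)}$ denotes the subsemigroup of all $A\in\mathcal{S}$ that can be represented as $A=B_1\cdots B_k$ with $B_1,\ldots,B_k\in\mathcal{S}$. A semigroup is commutative if $AB=BA$ for all its elements $A,B$. $\mathcal{S}$ is called quasinilpotent if $\mathcal{S}^{(k)}$ is a commutative semigroup for some $k\ge 1$. A semigroup $\mathcal{S}$ with a zero element $0$ is called nilpotent if $\mathcal{S}^{(k)}=\{0\}$ for some $k\ge 1$. *)

(* Defs.v *)
From HB Require Import structures.
From mathcomp Require Import all_boot all_order all_algebra.
From mathcomp Require Import complex.
From mathcomp Require Import all_classical all_reals topology normedtype.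

Set Implicit Arguments.
Unset Strict Implicit.
Unset Printing Implicit Defensive.

Import Order.TTheory GRing.Theory Num.Theory.
Import numFieldNormedType.Exports.
Local Open Scope classical_set_scope.
Local Open Scope ring_scope.

(* R[i], packed as a numFieldType so that MathComp-Analysis equips it, and
   column vectors over it, with the topology of the complex modulus. *)
Definition Cplx (R : realType) : numFieldType := R[i].

(* The semifield R_+ : nonnegative reals with the usual operations. *)
Record nnreal (R : realType) := NNReal {
  nnval :> R;
  nnvalP : nnval \is Num.nneg }.

HB.instance Definition _ (R : realType) := [isSub for @nnval R].
HB.instance Definition _ (R : realType) := [Choice of nnreal R by <:].
HB.instance Definition _ (R : realType) :=
  [SubChoice_isSubComNzSemiRing of nnreal R by <:].

(* The semifield R_+(max) : same carrier, but x + y is the maximum. *)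
Definition maxreal (R : realType) : Type := nnreal R.

Section MaxReal.
Variable R : realType.
Implicit Types x y z : maxreal R.

HB.instance Definition _ := Choice.on (maxreal R).

Lemma maxreal_add_subproof x y : Num.max (nnval x) (nnval y) \is Num.nneg.
Proof.
have := nnvalP x; rewrite !qualifE /= => x0.
by rewrite le_max x0.
Qed.

Definition maxreal_add x y : maxreal R := NNReal (maxreal_add_subproof x y).
Definition maxreal_mul x y : maxreal R := (x : nnreal R) * (y : nnreal R).

Lemma maxreal_addA : associative maxreal_add.
Proof. by move=> x y z; apply: val_inj; rewrite /= maxA. Qed.

Lemma maxreal_addC : commutative maxreal_add.
Proof. by move=> x y; apply: val_inj; rewrite /= maxC. Qed.

Lemma maxreal_add0 : left_id (0 : nnreal R) maxreal_add.
Proof.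
by move=> x; apply: val_inj => /=; apply/max_idPr; have := nnvalP x.
Qed.

HB.instance Definition _ := GRing.isNmodule.Build (maxreal R)
  maxreal_addA maxreal_addC maxreal_add0.

Lemma maxreal_mulDl : left_distributive maxreal_mul maxreal_add.
Proof.
move=> x y z; apply: val_inj; rewrite /= maxr_pMl //.
by have := nnvalP z.
Qed.

HB.instance Definition _ := GRing.Nmodule_isComNzSemiRing.Build (maxreal R)
  (@mulrA (nnreal R)) (@mulrC (nnreal R)) (@mul1r (nnreal R))
  maxreal_mulDl (@mul0r (nnreal R)) (oner_neq0 (nnreal R)).

End MaxReal.

Lemma nnvalD (R : realType) (x y : nnreal R) : nnval (x + y) = nnval x + nnval y.
Proof. by []. Qed.

Lemma nnvalM (R : realType) (x y : nnreal R) : nnval (x * y) = nnval x * nnval y.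
Proof. by []. Qed.

Lemma maxvalD (R : realType) (x y : maxreal R) :
  nnval (x + y) = Num.max (nnval x) (nnval y).
Proof. by []. Qed.

Lemma maxvalM (R : realType) (x y : maxreal R) :
  nnval (x * y) = nnval x * nnval y.
Proof. by []. Qed.

Lemma maxval0 (R : realType) : nnval (0 : maxreal R) = 0.
Proof. by []. Qed.

Lemma maxval1 (R : realType) : nnval (1 : maxreal R) = 1.
Proof. by []. Qed.

(* For vectors with entries in R_+ or R_+(max), the Euclidean topology is the
   one inherited from R^n, in which R_+^n is closed. *)
Definition closed_cone (R : realType) (n : nat) (V : set 'cV[nnreal R]_n) :=
  closed [set map_mx (@nnval R) v | v in V].

Definition closed_max_cone (R : realType) (n : nat) (V : set 'cV[maxreal R]_n) :=
  closed [set map_mx (@nnval R) v | v in V].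

Section Semigroups.
Variables (K : comNzSemiRingType) (n : nat).
Implicit Types (S : set 'M[K]_n) (V : set 'cV[K]_n).

Definition linear_subspace V :=
  [/\ V 0, forall u v, V u -> V v -> V (u + v)
    & forall (a : K) v, V v -> V (a *: v)].

Definition nontrivial_subspace V := exists2 v, V v & v <> 0.

Definition op_semigroup S := forall A B, S A -> S B -> S (A *m B).

Definition commutative_semigroup S :=
  forall A B, S A -> S B -> A *m B = B *m A.

(* The set S^(k); the product is that of the matrix semiring 'M[K]_n. *)
Definition sgpow S (k : nat) : set 'M[K]_n :=
  [set A | S A /\ exists2 B : 'I_k -> 'M[K]_n,
                    forall i, S (B i) & A = \prod_(i < k) B i].

Definition quasinilpotent_semigroup S :=
  exists2 k : nat, (0 < k)%N & commutative_semigroup (sgpow S k).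

(* A zero element of S is only required to be absorbing in S: it need not be
   the zero matrix. *)
Definition zero_element S Z :=
  S Z /\ forall A, S A -> Z *m A = Z /\ A *m Z = Z.

Definition nilpotent_semigroup S :=
  exists2 Z, zero_element S Z &
    exists2 k : nat, (0 < k)%N & sgpow S k = [set Z].

Definition leaves_invariant S V := forall A v, S A -> V v -> V (A *m v).

Definition has_eigenvector S V :=
  exists v, [/\ V v, v <> 0 &
    forall A, S A -> exists lambda : K, A *m v = lambda *: v].

End Semigroups.

(* Main.v *)
(* First let S be commutative. Over C, a nonzero S-invariant subspace of V of least
   dimension lies in an eigenspace of every A in S. Over R_+ and R_+(max), a single
   A has an eigenvector in every nontrivial closed invariant subspace, found by
   minimizing r under A u <= r u. Eigenspaces being closed and S-invariant, finitely
   many operators have a common eigenvector, and compactness of the set of v in V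
   whose entries sum to 1 extends this to all of S.

   In general let v be a common eigenvector of S^(k). If B v = b v with B in S^(k)
   and b <> 0, then A v = b^-1 (A B) v with A B in S^(k) for all A in S. Otherwise
   S^(k) v = 0, and the last nonzero product B_1 ... B_j v is killed by S. *)
Require Import Defs.
From mathcomp Require Import all_boot all_order all_algebra.
From mathcomp Require Import all_classical all_reals topology normedtype.
Import numFieldNormedType.Exports.
From mathcomp Require Import complex sequences.
From mathcomp Require Import ring lra.
Import Order.TTheory GRing.Theory Num.Theory.
Set Implicit Arguments.
Unset Strict Implicit.
Unset Printing Implicit Defensive.
Local Open Scope classical_set_scope.
Local Open Scope ring_scope.

(** * Reduction to commutative semigroups *)

Section QuasinilpotentReduction.
Variables (K : comNzSemiRingType) (n : nat).
Implicit Types (S : set 'M[K]_n) (V : set 'cV[K]_n).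

Lemma nilpotent_quasinilpotent S :
  nilpotent_semigroup S -> quasinilpotent_semigroup S.
Proof.
case=> Z _ [k k_gt0 Sk]; exists k => //.
by rewrite Sk => A B /= -> ->.
Qed.

(** The factor [A] is absorbed into the first of the [k] factors of [B]. Thus [sgpow S k] is a left
    ideal of [S], which lets eigenvalue equations pass from it to [S]. *)
Lemma sgpow_mull S k A B : (0 < k)%N -> op_semigroup S ->
  S A -> sgpow S k B -> sgpow S k (A *m B).
Proof.
case: k => // k _ Ssg SA [SB [B_ SB_ defB]]; split; first exact: Ssg.
exists (fun i => if i == ord0 then A *m B_ i else B_ i) => [i|].
  by case: ifP => _; [exact: Ssg|].
by rewrite defB !big_ord_recl /= [in LHS]mulmxA.
Qed.

(** The sequence has to be nonempty because [S] may lack the identity matrix. *)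
Lemma op_semigroup_prod S (s : seq 'M[K]_n) : op_semigroup S ->
  (0 < size s)%N -> (forall B, B \in s -> S B) -> S (\prod_(B <- s) B).
Proof.
move=> Ssg; elim: s => // B [|C s] IHs _ Ss.
  by rewrite big_seq1; apply: Ss; rewrite inE.
rewrite big_cons; apply: (Ssg); first by apply: Ss; rewrite inE eqxx.
by apply: IHs => // D sD; apply: Ss; rewrite inE sD orbT.
Qed.

Lemma sgpow_prod_seq S k (s : seq 'M[K]_n) : (0 < k)%N -> op_semigroup S ->
  size s = k -> (forall B, B \in s -> S B) -> sgpow S k (\prod_(B <- s) B).
Proof.
move=> k_gt0 Ssg sz_s Ss; split; first by apply: op_semigroup_prod; rewrite ?sz_s.
exists (fun i : 'I_k => s`_i) => [i|]; first by apply/Ss/mem_nth; rewrite sz_s.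
by rewrite (big_nth 0) sz_s big_mkord.
Qed.

(** Either every [A] in [S] kills [w], which is then an eigenvector with all eigenvalues 0, or some
    [A *m w] is nonzero and is killed by all products of one factor fewer. *)
Lemma eigenvector_of_killed S V w j : leaves_invariant S V ->
  V w -> w <> 0 ->
  (forall s : seq 'M[K]_n, size s = j -> (forall B, B \in s -> S B) ->
     (\prod_(B <- s) B) *m w = 0) ->
  has_eigenvector S V.
Proof.
move=> SV; elim: j w => [|j IHj] w Vw w0 kill.
  by case: w0; have := kill [::] erefl; rewrite big_nil mul1mx; apply.
have [killed|/existsNP[A /not_implyP[SA Aw0]]] :=
    pselect (forall A, S A -> A *m w = 0).
  by exists w; split=> // A /killed->; exists 0; rewrite scale0r.
apply: (IHj (A *m w)) => // [|s sz_s Ss]; first exact: SV.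
have := kill (rcons s A); rewrite size_rcons sz_s -cats1 big_cat big_seq1.
rewrite -mulmxA; apply=> // B; rewrite mem_cat inE => /orP[/Ss//|/eqP->//].
Qed.

Lemma eigenvector_of_sgpow S V k :
    (forall x : K, x <> 0 -> exists y, y * x = 1) ->
    (0 < k)%N -> op_semigroup S -> leaves_invariant S V ->
  has_eigenvector (sgpow S k) V -> has_eigenvector S V.
Proof.
move=> Kinv k_gt0 Ssg SV [v [Vv v0 eig]].
have [[B [mu [SB Bv mu0]]]|nonz] := pselect
    (exists B mu, [/\ sgpow S k B, B *m v = mu *: v & mu <> 0]).
  have [nu nuK] := Kinv _ mu0.
  exists v; split=> // A SA.
  have [la ABv] := eig _ (sgpow_mull k_gt0 Ssg SA SB).
  exists (nu * la); rewrite -scalerA -ABv -mulmxA Bv -scalemxAr scalerA nuK.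
  by rewrite scale1r.
apply: (@eigenvector_of_killed S V v k) => // s sz_s Ss.
have Sps := sgpow_prod_seq k_gt0 Ssg sz_s Ss.
have [la sv] := eig _ Sps; rewrite sv.
have [->|/eqP la0] := eqVneq la 0; first by rewrite scale0r.
by case: nonz; exists (\prod_(B <- s) B), la.
Qed.

Lemma has_eigenvector_quasinilpotent S V :
    (forall x : K, x <> 0 -> exists y, y * x = 1) ->
    (forall T, commutative_semigroup T -> leaves_invariant T V ->
       has_eigenvector T V) ->
    op_semigroup S -> quasinilpotent_semigroup S \/ nilpotent_semigroup S ->
  leaves_invariant S V -> has_eigenvector S V.
Proof.
move=> Kinv comm_eig Ssg qS SV.
have [k k_gt0 Skcomm] : quasinilpotent_semigroup S.
  by case: qS => // /nilpotent_quasinilpotent.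
apply: (eigenvector_of_sgpow Kinv k_gt0) => //.
by apply: comm_eig => // A v [SA _]; exact: SV.
Qed.

End QuasinilpotentReduction.

(** * Commuting operators over an algebraically closed field *)

Section NumClosedField.
Variables (C : numClosedFieldType) (n : nat).
Implicit Types (S : set 'M[C]_n) (V : set 'cV[C]_n).

(** The restriction of [A] to the row space of [M] has an eigenvalue, the field being algebraically
    closed. Its eigenvector [z], in coordinates over [row_base M], is carried back to
    [z *m row_base M]. *)
Lemma stable_eigenvector (M A : 'M[C]_n) : M != 0 -> stablemx M A ->
  exists a, (M :&: eigenspace A a)%MS != 0.
Proof.
move=> M0 stM.
have rM : (0 < \rank M)%N by rewrite lt0n mxrank_eq0.
have [a /eigenvalueP[z /= za z0]] := eigenvalue_closed (restrictmx M A) rM.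
exists a; apply: contra_neq z0 => cap0.
have : (z *m row_base M <= M :&: eigenspace A a)%MS.
  rewrite sub_capmx (submx_trans (submxMl _ _)) ?eq_row_base//=.
  apply/eigenspaceP; rewrite scalemxAl -za -[LHS]mulmxA -[RHS]mulmxA.
  by rewrite /conjmx mulmxKpV ?stablemx_row_base.
by rewrite cap0 submx0 mulmx_free_eq0 ?row_base_free// => /eqP.
Qed.

Definition rowspace_of V (M : 'M[C]_n) := forall x : 'rV[C]_n, (x <= M)%MS <-> V x^T.

(** Among the matrices with row space inside [V] take one of maximal rank: adjoining a vector of [V]
    cannot raise the rank, so the vector was already in the row space. *)
Lemma linear_subspace_rowspace V : linear_subspace V -> exists M, rowspace_of V M.
Proof.
case=> V0 VD VZ.
pose P k := `[< exists2 M : 'M[C]_n, (forall x : 'rV_n, (x <= M)%MS -> V x^T) & \rank M = k >].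
have exP : exists k, P k.
  exists 0%N; apply/asboolP; exists 0; last exact: mxrank0.
  by move=> x; rewrite submx0 => /eqP->; rewrite trmx0.
have bndP k : P k -> (k <= n)%N by case/asboolP=> M _ <-; exact: rank_leq_row.
case: (ex_maxnP exP bndP) => k /asboolP[M VM rM] maxk.
exists M => x; split=> [/VM//|Vx].
have Pr : P (\rank (M + x)%MS).
  apply/asboolP; exists (M + x)%MS => // y /sub_addsmxP[[z t] /= ->].
  rewrite linearD /=; apply: VD; first by apply: VM; exact: submxMl.
  by rewrite [t]mx11_scalar mul_scalar_mx linearZ /=; exact: VZ.
have /mxrank_leqif_sup leM : (M <= M + x)%MS by exact: addsmxSl.
have := maxk _ Pr; rewrite -rM (geq_leqif leM).
exact/submx_trans/addsmxSr.
Qed.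

Lemma commuting_eigenvector S V : linear_subspace V -> nontrivial_subspace V ->
  commutative_semigroup S -> leaves_invariant S V -> has_eigenvector S V.
Proof.
move=> Vlin [v0 Vv0 v00] Scomm SV.
have [M0 VM0] := linear_subspace_rowspace Vlin.
(* These [M] are the nonzero invariant subspaces of [V]. Vectors being rows here, [A] acts on the
   right through [A^T]. *)
pose Q (M : 'M[C]_n) := [/\ M != 0, (M <= M0)%MS & forall A, S A -> stablemx M A^T].
pose P k := `[< exists2 M : 'M[C]_n, Q M & \rank M = k >].
have exP : exists k, P k.
  exists (\rank M0); apply/asboolP; exists M0 => //; split=> // [|A SA].
    apply: contra_notN v00 => /eqP M00; apply: trmx_inj; rewrite trmx0; apply/eqP.
    by rewrite -submx0 -M00; apply/VM0; rewrite trmxK.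
  apply/row_subP => i; apply/VM0; rewrite row_mul trmx_mul trmxK.
  by apply: SV => //; apply/VM0; exact: row_sub.
case: (ex_minnP exP) => k /asboolP[M [M0' MM0 Mst] rM] mink.
exists (nz_row M)^T; split.
- by apply/VM0; exact: submx_trans (nz_row_sub _) MM0.
- move=> /(congr1 trmx)/eqP; rewrite trmxK trmx0 nz_row_eq0; exact/negP.
move=> A SA; have [a Ma] := stable_eigenvector M0' (Mst A SA); exists a.
(* This part of [M] is nonzero, and invariant because the operators commute; by minimality of the
   rank it is all of [M]. *)
pose M' := (M :&: eigenspace A^T a)%MS.
have QM' : Q M'.
  split=> // [|B SB]; first exact: submx_trans (capmxSl _ _) MM0.
  rewrite sub_capmx (submx_trans (submxMr _ (capmxSl _ _)) (Mst B SB))/=.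
  apply: submx_trans (submxMr _ (capmxSr _ _)) _.
  by apply: comm_mx_stable_eigenspace; rewrite /comm_mx -!trmx_mul Scomm.
have /mxrank_leqif_sup leM : (M' <= M)%MS by exact: capmxSl.
have : P (\rank M') by apply/asboolP; exists M'.
move=> /mink; rewrite -rM (geq_leqif leM) => MM'.
have /eigenspaceP : (nz_row M <= eigenspace A^T a)%MS.
  exact: submx_trans (nz_row_sub _) (submx_trans MM' (capmxSr _ _)).
by move=> /(congr1 trmx); rewrite trmx_mul trmxK linearZ.
Qed.

End NumClosedField.

(** * Preliminaries on real vectors and a Bernoulli inequality *)

Lemma cvg_mx (R : numFieldType) m p (T : Type) (F : set_system T) {FF : Filter F}
    (f : T -> 'M[R]_(m, p)) (M : 'M[R]_(m, p)) :
  (forall i j, f x i j @[x --> F] --> M i j) -> f @ F --> M.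
Proof.
move=> fM U [P MP PU]; apply: filterS PU _ => /=.
apply: filter_forall => i; apply: filter_forall => j.
exact: (fM i j _ (MP i j)).
Qed.

(** Tychonoff's theorem for row vectors, carried to columns by the continuous transposition. *)
Lemma compact_unit_cube (R : realType) n :
  compact [set x : 'cV[R]_n | forall i, x i 0 \in `[0, 1]].
Proof.
have -> : [set x : 'cV[R]_n | forall i, x i 0 \in `[0, 1]] =
    trmx @` [set x : 'rV[R]_n | forall i, (`[0, 1]%classic : set R) (x ord0 i)].
  apply/seteqP; split=> [x x01|_ [x x01 <-] i]; last by rewrite mxE; exact: x01.
  by exists x^T; rewrite ?trmxK // => i; rewrite mxE; exact: x01.
apply: continuous_compact; last first.
  by apply: (@rV_compact R n (fun=> `[0, 1]%classic)) => _; exact: segment_compact.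
apply: continuous_subspaceT => x; apply: (@cvg_mx R _ _ _ (nbhs x) (nbhs_filter x) trmx) => i j.
by rewrite mxE; under eq_fun do rewrite mxE; exact: coord_continuous.
Qed.

Lemma bernoulli_sub (R : realDomainType) (x : R) k :
  0 <= x <= 1 -> 1 - x *+ k <= (1 - x) ^+ k.
Proof.
case/andP=> x0 x1; elim: k => [|k IHk]; first by rewrite mulr0n subr0.
rewrite exprS; apply: le_trans (ler_wpM2l _ IHk); last by rewrite subr_ge0.
rewrite mulrS (_ : _ * _ = 1 - (x + x *+ k) + x * (x *+ k)); last by ring.
by rewrite lerDl mulr_ge0 ?mulrn_wge0.
Qed.

(* Both R_+ and R_+(max) are the half-line, carried by [val] into R, with the usual
   product and a continuous, monotone, extensive addition [op]. *)
Section PositiveSemifield.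
Variables (R : realType) (K : comNzSemiRingType) (val : K -> R) (op : R -> R -> R).
Hypotheses (val_inj : injective val) (val_ge0 : forall x, 0 <= val x).
Hypothesis val_surj : forall r : R, 0 <= r -> exists x, val x = r.
Hypothesis valM : forall x y, val (x * y) = val x * val y.
Hypothesis valD : forall x y, val (x + y) = op (val x) (val y).
Hypothesis op_cont : continuous (fun p : R * R => op p.1 p.2).
Hypothesis op_ge : forall a b : R, 0 <= a -> 0 <= b -> a <= op a b.
Hypothesis op_le : forall a b c, a <= b -> op a c <= op b c.

(** Surjectivity gives some [z] of value 0, and [0 = 0 * z] with multiplicativity does the rest. *)
Lemma val0 : val 0 = 0.
Proof.
have [z z0] := val_surj (lexx 0).
by rewrite -(mul0r z) valM z0 mulr0.
Qed.

Lemma val_eq0 x : (val x == 0) = (x == 0).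
Proof. by rewrite -[in LHS]val0 (inj_eq val_inj). Qed.

Lemma val1 : val 1 = 1.
Proof.
have v1 : val 1 != 0 by rewrite val_eq0 oner_neq0.
by apply: (mulfI v1); rewrite mulr1 -valM mulr1.
Qed.

Lemma val_gt0 x : (0 < val x) = (x != 0).
Proof. by rewrite lt0r val_ge0 andbT val_eq0. Qed.

Lemma exists_inv (x : K) : x <> 0 -> exists y, y * x = 1.
Proof.
move=> /eqP x0; have [|y yE] := @val_surj (val x)^-1; first by rewrite invr_ge0.
by exists y; apply: val_inj; rewrite valM yE val1 mulVf ?val_eq0.
Qed.

Lemma val_leDl x y : val x <= val (x + y).
Proof. by rewrite valD op_ge. Qed.

Lemma val_leDr x y : val x <= val (y + x).
Proof. by rewrite addrC val_leDl. Qed.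

Lemma val_leD x y z t : val x <= val y -> val z <= val t ->
  val (x + z) <= val (y + t).
Proof.
move=> xy zt; rewrite !valD; apply: le_trans (op_le _ xy) _.
by rewrite -!valD ![y + _]addrC !valD op_le.
Qed.

Lemma val_leM x y z t : val x <= val y -> val z <= val t ->
  val (x * z) <= val (y * t).
Proof. by move=> xy zt; rewrite !valM ler_pM. Qed.

Lemma val_le_sum (I : finType) (f g : I -> K) :
  (forall i, val (f i) <= val (g i)) -> val (\sum_i f i) <= val (\sum_i g i).
Proof.
move=> fg; elim/big_ind2 : _ => // x1 x2 y1 y2; exact: val_leD.
Qed.

Lemma val_le_sum1 (I : finType) (f : I -> K) i : val (f i) <= val (\sum_i f i).
Proof. by rewrite (bigD1 i) //= val_leDl. Qed.

(** * Entrywise order and normalization of vectors *)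

Variable n : nat.
Implicit Types (u v w : 'cV[K]_n) (A B : 'M[K]_n) (V : set 'cV[K]_n).

Definition vle v w := forall i, val (v i 0) <= val (w i 0).

Lemma vle_refl v : vle v v. Proof. by []. Qed.

Lemma vle_trans v u w : vle u v -> vle v w -> vle u w.
Proof. by move=> uv vw i; exact: le_trans (uv i) (vw i). Qed.

Lemma vle_addr v w : vle v (v + w).
Proof. by move=> i; rewrite mxE val_leDl. Qed.

Lemma vle_mulmx A v w : vle v w -> vle (A *m v) (A *m w).
Proof.
by move=> vw i; rewrite !mxE; apply: val_le_sum => j; exact: val_leM.
Qed.

Lemma vle_scale a b v w : val a <= val b -> vle v w -> vle (a *: v) (b *: w).
Proof. by move=> ab vw i; rewrite !mxE val_leM. Qed.

Lemma vle0 v : vle v 0 -> v = 0.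
Proof.
move=> v0; apply/matrixP => i j; rewrite ord1; apply: val_inj.
by apply/eqP; rewrite eq_le v0 mxE val0 val_ge0.
Qed.

Lemma vneq0 v : v <> 0 -> exists i, v i 0 != 0.
Proof.
move=> v0; apply: contra_notP v0 => /forallNP v0; apply/matrixP => i j.
by rewrite ord1 mxE; apply/eqP; have /negP/negPn := v0 i.
Qed.

(** Over R_+ this is the l1 norm, over R_+(max) the maximum norm. *)
Definition total v := \sum_i v i 0.

Lemma totalZ c v : total (c *: v) = c * total v.
Proof. by rewrite /total mulr_sumr; apply: eq_bigr => i _; rewrite mxE. Qed.

Lemma val_le_total v i : val (v i 0) <= val (total v).
Proof. exact: (val_le_sum1 (fun i => v i 0)). Qed.

Lemma total_neq0 v : v <> 0 -> total v <> 0.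
Proof.
case/vneq0 => i vi0 Nv0; have := val_le_total v i; rewrite Nv0 val0.
by rewrite le_eqVlt ltNge val_ge0 orbF val_eq0 (negPf vi0).
Qed.

Lemma total1_neq0 v : total v = 1 -> v <> 0.
Proof.
move=> Nv v0; have : (1 : K) != 0 by exact: oner_neq0.
by rewrite -Nv v0 /total big1 ?eqxx// => i _; rewrite mxE.
Qed.

Lemma normalize V v : linear_subspace V -> V v -> v <> 0 ->
  exists c, [/\ c <> 0, V (c *: v) & total (c *: v) = 1].
Proof.
case=> _ _ VZ Vv v0; have [c cK] := exists_inv (total_neq0 v0).
exists c; split; [|exact: VZ|by rewrite totalZ].
move=> c0; have : (1 : K) != 0 by exact: oner_neq0.
by rewrite -cK c0 mul0r eqxx.
Qed.

(** * Closed sets, continuity and compactness *)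

Notation vmap := (map_mx val : 'cV[K]_n -> 'cV[R]_n).

Definition vclosed V := closed [set vmap v | v in V].

(** [K] carries no topology, so continuity is expressed by a continuous extension [F] to all of
    R^n. *)
Definition vcont (f : 'cV[K]_n -> K) :=
  exists2 F : 'cV[R]_n -> R, continuous F & forall v, val (f v) = F (vmap v).

Lemma vmap_inj : injective vmap.
Proof.
by move=> v w /matrixP vw; apply/matrixP => i j; apply: val_inj; have := vw i j; rewrite !mxE.
Qed.

Lemma vcont_cst c : vcont (fun=> c).
Proof. by exists (fun=> val c) => //; exact: cst_continuous. Qed.

Lemma vcont_coord i : vcont (fun v => v i 0).
Proof.
by exists (fun x => x i 0) => [|v]; [exact: coord_continuous|rewrite mxE].
Qed.

Lemma vcont_mul f g : vcont f -> vcont g -> vcont (fun v => f v * g v).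
Proof.
move=> [F cF fF] [G cG gG]; exists (fun x => F x * G x) => [x|v].
  exact: (continuousM (cF x) (cG x)).
by rewrite valM fF gG.
Qed.

Lemma vcont_sum (I : finType) (f : I -> 'cV[K]_n -> K) :
  (forall i, vcont (f i)) -> vcont (fun v => \sum_i f i v).
Proof.
move=> cf; pose F i := sval (cid2 (cf i)).
exists (fun x => \big[op/val 0]_i F i x).
  by apply: continuous_big => // i _; rewrite /F; case: cid2.
move=> v; rewrite (big_morph val valD (erefl (val 0))).
by apply: eq_bigr => i _; rewrite /F; case: cid2.
Qed.

Lemma vcont_total : vcont total.
Proof. by apply: vcont_sum => i; exact: vcont_coord. Qed.

Lemma vcont_mulmx A i : vcont (fun v => (A *m v) i 0).
Proof.
have -> : (fun v => (A *m v) i 0) = (fun v => \sum_j A i j * v j 0).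
  by apply/funext => v; rewrite mxE.
apply: vcont_sum => j; apply: vcont_mul; [exact: vcont_cst|exact: vcont_coord].
Qed.

Lemma vcont_scale f i : vcont f -> vcont (fun v => (f v *: v) i 0).
Proof.
move=> cf; have -> : (fun v => (f v *: v) i 0) = (fun v => f v * v i 0).
  by apply/funext => v; rewrite mxE.
by apply: vcont_mul => //; exact: vcont_coord.
Qed.

Lemma vcont_total_mulmx A : vcont (fun v => total (A *m v)).
Proof. by apply: vcont_sum => i; exact: vcont_mulmx. Qed.

(** The image under [vmap] is that of [V] cut by the sets [0 <= G i - F i], closed since [F i] and
    [G i] are continuous on the whole space. The index [i] lets one statement cover vector
    inequalities. *)
Lemma vclosed_le (I : Type) V (f g : I -> 'cV[K]_n -> K) :
  vclosed V -> (forall i, vcont (f i)) -> (forall i, vcont (g i)) ->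
  vclosed [set v | V v /\ forall i, val (f i v) <= val (g i v)].
Proof.
move=> cV cf cg; pose F i := sval (cid2 (cf i)); pose G i := sval (cid2 (cg i)).
have fF i v : val (f i v) = F i (vmap v) by rewrite /F; case: cid2.
have gG i v : val (g i v) = G i (vmap v) by rewrite /G; case: cid2.
have cF i : continuous (F i) by rewrite /F; case: cid2.
have cG i : continuous (G i) by rewrite /G; case: cid2.
rewrite /vclosed (_ : [set _ | _ in _] =
    [set vmap v | v in V] `&` \bigcap_i [set x | 0 <= G i x - F i x]).
  apply: closedI => //; apply: closed_bigI => i _.
  have /continuous_closedP/(_ _ (@closed_ge _ 0)) : continuous (fun x => G i x - F i x).
    by move=> x; apply: continuousB; [exact: cG|exact: cF].
  by [].
apply/seteqP; split=> [_ [v [Vv fg] <-]|_ [[v Vv <-] fg]].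
  by split=> [|i _ /=]; [exists v|rewrite -fF -gG subr_ge0].
exists v => //; split=> // i; rewrite -subr_ge0 fF gG; exact: fg.
Qed.

Lemma vclosed_eq (I : Type) V (f g : I -> 'cV[K]_n -> K) :
  vclosed V -> (forall i, vcont (f i)) -> (forall i, vcont (g i)) ->
  vclosed [set v | V v /\ forall i, f i v = g i v].
Proof.
move=> cV cf cg; have := vclosed_le (vclosed_le cV cf cg) cg cf.
congr (vclosed _); apply/seteqP; split=> v /= [].
  move=> [Vv fg] gf; split=> // i; apply: val_inj.
  by apply/eqP; rewrite eq_le fg gf.
by move=> Vv fg; do !split=> //; move=> i; rewrite fg.
Qed.

(** Entries of a vector of total 1 are at most 1, so the images are closed subsets of the compact
    unit cube. Injectivity of [vmap] turns a common image point into a common vector. *)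
Lemma vclosed_finI (I : choiceType) (D : set I) (F : I -> set 'cV[K]_n) :
  (forall i, D i -> vclosed (F i)) ->
  (forall i v, D i -> F i v -> total v = 1) ->
  finI D F -> \bigcap_(i in D) F i !=set0.
Proof.
move=> cF NF finF.
have [[i0 Di0]|D0] := pselect (exists i, D i); last first.
  by exists 0 => i Di; case: D0; exists i.
have := compact_unit_cube (R := R) (n := n).
rewrite compact_In0 => /(_ I D (fun i => vmap @` (F i))) [].
- exists (fun i => vmap @` F i) => // i Di; rewrite setIidr// => _ [v Fv <-] j.
  rewrite mxE in_itv/= val_ge0/= -val1 -(NF _ _ Di Fv); exact: val_le_total.
- by move=> D' sD; have [v Fv] := finF D' sD; exists (vmap v) => i iD'; exists v => //; exact: Fv.
- move=> x Fx; have [v Fv vx] := Fx _ Di0; exists v => i Di.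
  by have [w Fw] := Fx _ Di; rewrite -vx => /vmap_inj <-.
Qed.

(** * Eigenvectors of a single operator *)

Lemma exists_min_seq (s : seq K) :
  s = [::] \/ exists2 c, c \in s & forall b, b \in s -> val c <= val b.
Proof.
elim: s => [|a s [->|[c sc minc]]]; [by left| |]; right.
  by exists a => [|b]; rewrite inE// => /eqP->.
have [ac|/ltW ca] := leP (val a) (val c).
  exists a => [|b]; rewrite inE ?eqxx// => /orP[/eqP->//|/minc].
  exact: le_trans.
exists c => [|b]; rewrite inE ?sc ?orbT// => /orP[/eqP->//|].
exact: minc.
Qed.

(* Take u in V of maximal support: u + A u is in V too, so A u vanishes where u
   does. *)
Lemma exists_superinvariant V A : linear_subspace V -> nontrivial_subspace V ->
  (forall v, V v -> V (A *m v)) ->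
  exists u c, [/\ V u, u <> 0 & vle (A *m u) (c *: u)].
Proof.
move=> [V0 VD VZ] [v0 Vv0 v00] AV.
pose supp v := [set i | v i 0 != 0]%SET.
pose P k := `[< exists2 v, V v & #|supp v| = k >].
have exP : exists k, P k by exists #|supp v0|; apply/asboolP; exists v0.
have bndP k : P k -> (k <= n)%N.
  by case/asboolP=> v _ <-; rewrite -[leqRHS]card_ord max_card.
case: (ex_maxnP exP bndP) => k /asboolP[u Vu uk] maxk.
have u0 : u <> 0.
  move=> u0; have /maxk : P #|supp v0| by apply/asboolP; exists v0.
  rewrite -uk u0 leqNgt => /negP; apply; apply: (@leq_ltn_trans 0%N).
    by rewrite leqn0 cards_eq0; apply/eqP/setP => i; rewrite !inE mxE eqxx.
  by have [i vi] := vneq0 v00; rewrite card_gt0; apply/set0Pn; exists i; rewrite inE.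
have suppAu i : (A *m u) i 0 != 0 -> u i 0 != 0.
  move=> Aui; have sub : supp u \subset supp (u + A *m u).
    by apply/fintype.subsetP => j; rewrite !inE -!val_gt0 => /lt_le_trans; apply; exact: vle_addr.
  have /maxk : P #|supp (u + A *m u)|.
    by apply/asboolP; eexists; last reflexivity; apply: VD => //; exact: AV.
  rewrite -uk => le_card.
  have /setP/(_ i) : supp u = supp (u + A *m u) by apply/eqP; rewrite eqEcard sub.
  rewrite !inE => ->; rewrite -val_gt0 mxE; apply: lt_le_trans (val_leDr _ _).
  by rewrite val_gt0.
(* The sum serves as a bound for all the quotients. Where [u] vanishes the quotient is 0 by
   convention, and [suppAu] settles that entry. *)
pose r := \sum_i val ((A *m u) i 0) / val (u i 0).
have r_ge i : val ((A *m u) i 0) / val (u i 0) <= r.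
  by rewrite /r (bigD1 i)//= lerDl sumr_ge0// => j _; rewrite divr_ge0.
have [|c cr] := @val_surj r; first by apply: sumr_ge0 => j _; rewrite divr_ge0.
exists u, c; split=> // i; rewrite [in leRHS]mxE valM cr.
have [->|Aui] := eqVneq ((A *m u) i 0) 0; first by rewrite val0 mulr_ge0// -cr.
by rewrite -ler_pdivrMr ?val_gt0 ?suppAu.
Qed.

(** The sets [F c] grow with [c], so finitely many nonempty ones meet in the one of least [c]. By
    compactness a single [v] lies in all of them, and it attains the infimum of the admissible
    constants. *)
Lemma exists_min_superinvariant V A :
  linear_subspace V -> nontrivial_subspace V -> vclosed V ->
  (forall v, V v -> V (A *m v)) ->
  exists u r, [/\ V u, u <> 0, vle (A *m u) (r *: u) &
    forall w c, V w -> w <> 0 -> vle (A *m w) (c *: w) -> val r <= val c].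
Proof.
move=> Vlin Vnt cV AV; have [u0 [c0 [Vu0 u00 Au0]]] := exists_superinvariant Vlin Vnt AV.
(* [unit] puts the single equation in the indexed form of [vclosed_eq]. *)
pose F c := [set v | (V v /\ forall i : unit, total v = 1) /\ vle (A *m v) (c *: v)].
pose D := [set c | F c !=set0].
have inD w c : V w -> w <> 0 -> vle (A *m w) (c *: w) -> D c.
  move=> Vw w0 Aw; have [b [_ Vbw Nbw]] := normalize Vlin Vw w0.
  exists (b *: w); split=> //; rewrite -scalemxAr scalerA mulrC -scalerA.
  exact: vle_scale.
have [v Fv] : \bigcap_(c in D) F c !=set0.
  apply: vclosed_finI => [c _|c w _ [[_ /(_ tt)]] //|].
    apply: vclosed_le => [|i|i]; last first.
    - exact/vcont_scale/vcont_cst.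
    - exact: vcont_mulmx.
    by apply: vclosed_eq => // _; [exact: vcont_total|exact: vcont_cst].
  move=> D' sD.
  have [D'0|[c cD' minc]] := exists_min_seq (finmap.enum_fset D').
    by exists 0 => i /= iD'; have : i \in finmap.enum_fset D' by []; rewrite D'0.
  have := sD _ cD'; rewrite inE => -[w [Vw Aw]]; exists w => b bD'; split=> //.
  by apply: vle_trans Aw _; apply: vle_scale; [exact: minc|exact: vle_refl].
have Dc0 : D c0 by exact: inD Vu0 u00 Au0.
have [[Vv /(_ tt) Nv] _] := Fv _ Dc0.
have lbD : has_lbound (val @` D) by exists 0 => _ [c _ <-].
have neD : val @` D !=set0 by exists (val c0), c0.
have [|r rE] := @val_surj (inf (val @` D)).
  by apply: lb_le_inf => // _ [c _ <-].
exists v, r; split=> //; first exact: total1_neq0.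
  move=> i; rewrite [in leRHS]mxE valM rE.
  (* Where [v] vanishes so does [A *m v], by the bound for [c0]. Elsewhere the quotient of the
     entries is a lower bound of all admissible constants. *)
  have [vi0|vi0] := eqVneq (v i 0) 0.
    by have [_ /(_ i)] := Fv _ Dc0; rewrite [in leRHS]mxE vi0 mulr0 val0 mulr0.
  rewrite -ler_pdivrMr ?val_gt0//; apply: lb_le_inf => // _ [c Dc <-].
  by rewrite ler_pdivrMr ?val_gt0//; have [_ /(_ i)] := Fv _ Dc; rewrite [in leRHS]mxE valM.
move=> w c Vw w0 Aw; rewrite rE; apply: ge_inf => //; exists c => //.
exact: inD Aw.
Qed.

Lemma valX x k : val (x ^+ k) = val x ^+ k.
Proof. by elim: k => [|k IHk]; rewrite ?val1// !exprS valM IHk. Qed.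

(* Let r be the least constant with A u <= r u for some u <> 0 in V, and B = A / r.
   The iterates B^k u decrease to a fixed point of B in V. Were it 0, then
   B^N u <= a^N u for some N and a < 1, and t, the sum over k < N of
   a^(N-1-k) B^k u, would satisfy A t <= r a t, against the minimality of r. *)
Lemma exists_eigenvector V A :
  linear_subspace V -> nontrivial_subspace V -> vclosed V ->
  (forall v, V v -> V (A *m v)) ->
  exists v r, [/\ V v, v <> 0 & A *m v = r *: v].
Proof.
move=> Vlin Vnt cV AV; have [V0 VD VZ] := Vlin.
have [u [r [Vu u0 Au minr]]] := exists_min_superinvariant Vlin Vnt cV AV.
have [r0|/eqP r0] := eqVneq r 0.
  exists u, 0; split=> //; rewrite scale0r; apply: vle0.
  by move: Au; rewrite r0 scale0r.
have [q qr] := exists_inv r0.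
pose B := q *: A.
have rB v : r *: (B *m v) = A *m v.
  by rewrite -scalemxAl scalerA mulrC qr scale1r.
have BV v : V v -> V (B *m v).
  by move=> Vv; rewrite -scalemxAl; apply/VZ/AV.
have Bu : vle (B *m u) u.
  rewrite -[X in vle _ X]scale1r -qr -scalerA -scalemxAl.
  exact: vle_scale.
pose w k := iter k (mulmx B) u.
have Vw k : V (w k) by elim: k => //= k; exact: BV.
have w_dec k : vle (w k.+1) (w k).
  by elim: k => //= k IHk; exact: vle_mulmx.
pose x i := inf (range (fun k => val (w k i 0))).
have cvw i : val (w k i 0) @[k --> \oo] --> x i.
  apply: nonincreasing_cvgn; first by apply/nonincreasing_seqP => k; exact: w_dec.
  by exists 0 => _ [k _ <-].
have cvx : vmap (w k) @[k --> \oo] --> \col_i x i.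
  apply: cvg_mx => i j; rewrite ord1 mxE.
  by under eq_fun do rewrite mxE; exact: cvw.
have [y Vy yx] : [set vmap v | v in V] (\col_i x i).
  by apply: (closed_cvg _ cV _ _ cvx); near=> k; exists (w k).
have By : B *m y = y.
  apply/matrixP => i j; rewrite ord1; apply: val_inj.
  have [F cF FE] := vcont_mulmx B i.
  have -> : val (y i 0) = x i by have /matrixP/(_ i 0) := yx; rewrite !mxE.
  rewrite FE yx.
  (* These values are entries of [w k.+1], so the limit is unchanged by the shift, while continuity
     of [F] gives [F] of the limit vector. *)
  have : F (vmap (w k)) @[k --> \oo] --> x i.
    by under eq_fun do rewrite -FE; have := cvw i; rewrite -(cvg_shiftn 1); under eq_fun do rewrite addn1.
  apply: cvg_unique => //; exact: (continuous_cvg _ (cF _) cvx).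
have [y0|/eqP y0] := eqVneq y 0; last by exists y, r; rewrite -rB By.
(* The iterates tend to 0. Entries where [u] is 0 are treated apart: the decreasing iterates vanish
   there, whereas [val (u i 0) / 2] is positive elsewhere. *)
have /filter_ex[N wN] : \forall k \near \oo, forall i, val (w k i 0) <= val (u i 0) / 2.
  apply: filter_forall => i.
  have [ui0|ui0] := eqVneq (u i 0) 0.
    apply: filterE => k /=; rewrite ui0 val0 mul0r.
    elim: k => [|k]; first by rewrite /= ui0 val0.
    exact/le_trans/w_dec.
  have xi0 : x i = 0 by have /matrixP/(_ i 0) := yx; rewrite y0 !mxE val0.
  have := cvw i; rewrite xi0 => /cvgr_le; apply.
  by rewrite divr_gt0 // val_gt0.
(* With [a = 1 - h], Bernoulli's inequality gives [a ^+ N.+1 >= 1 - h *+ N.+1 = 1/2], hence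
   [w N.+1 <= w N <= u / 2 <= a ^+ N.+1 *: u]. *)
pose h : R := (2 * N.+1%:R)^-1.
have h01 : 0 < h < 1.
  rewrite invr_gt0 mulr_gt0//= invf_lt1 ?mulr_gt0//.
  by rewrite -natrM ltr1n mulnS.
have [|a aE] := @val_surj (1 - h); first by rewrite subr_ge0; case/andP: h01 => _ /ltW.
have a1 : val a < 1 by rewrite aE gtrBl; case/andP: h01.
have a0 : a != 0 by rewrite -val_gt0 aE subr_gt0; case/andP: h01.
have aN : 2^-1 <= val (a ^+ N.+1).
  rewrite valX aE; apply: le_trans (bernoulli_sub _ _); last by case/andP: h01 => /ltW-> /ltW.
  have -> : h *+ N.+1 = 2^-1 by rewrite -[LHS]mulr_natr /h invfM -mulrA mulVf ?mulr1 ?pnatr_eq0.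
  lra.
pose t := \sum_(k < N.+1) a ^+ (N - k) *: w k.
have Vt : V t by apply: big_ind => // k _; exact: VZ.
have t0 : t <> 0.
  move=> t0; have : vle (a ^+ N *: u) t.
    by rewrite /t big_ord_recl subn0; exact: vle_addr.
  rewrite t0 => /vle0 /matrixP au.
  case: (vneq0 u0) => i; rewrite -val_gt0 => ui.
  have := au i 0; rewrite !mxE => /(congr1 val); rewrite valM valX val0.
  by apply/eqP; rewrite mulf_neq0 ?expf_neq0 ?val_eq0// -val_eq0 gt_eqF.
(* Both sides are sums over shifted indices with equal terms, except that the left has [w N.+1]
   where the right has [a ^+ N.+1 *: u]. *)
have Bt : vle (B *m t) (a *: t).
  rewrite /t mulmx_sumr scaler_sumr big_ord_recr [X in vle _ X]big_ord_recl /=.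
  rewrite subnn expr0 scale1r subn0 scalerA -exprS addrC => i.
  rewrite [in leLHS]mxE [in leRHS]mxE; apply: val_leD.
    rewrite [in leRHS]mxE valM; apply: le_trans (w_dec N i) _; apply: le_trans (wN i) _.
    by rewrite mulrC ler_wpM2r.
  rewrite le_eqVlt; apply/orP; left; apply/eqP; congr (val (fun_of_matrix _ _ _)).
  apply: eq_bigr => k _; rewrite -scalemxAr scalerA -exprS; congr (_ ^+ _ *: _).
  by rewrite /bump /= add1n subnSK.
have : val r <= val (r * a).
  by apply: minr Vt t0 _; rewrite -rB -scalerA; exact: vle_scale.
rewrite valM leNgt gtr_pMr ?a1// val_gt0; exact/eqP.
Unshelve. all: by end_near. Qed.

(** * Common eigenvectors of commuting operators *)

Lemma linear_subspace_eigenspace V A r : linear_subspace V ->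
  linear_subspace [set v | V v /\ forall i, (A *m v) i 0 = (r *: v) i 0].
Proof.
case=> V0 VD VZ; split=> [|u v [Vu Au] [Vv Av]|c v [Vv Av]].
- by split=> // i; rewrite mulmx0 scaler0.
- split=> [|i]; first exact: VD.
  by rewrite mulmxDr scalerDr mxE [in RHS]mxE Au Av.
split=> [|i]; first exact: VZ.
by rewrite -scalemxAr scalerA mulrC -scalerA mxE [in RHS]mxE Av.
Qed.

(** The eigenspace of the first operator inside [V] is again a nontrivial closed subspace, and the
    remaining operators preserve it because they commute with the first. *)
Lemma exists_eigenvector_seq (s : seq 'M[K]_n) V :
  linear_subspace V -> nontrivial_subspace V -> vclosed V ->
  {in s &, forall A B, A *m B = B *m A} ->
  (forall A v, A \in s -> V v -> V (A *m v)) ->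
  exists v, [/\ V v, v <> 0 & forall A, A \in s -> exists r, A *m v = r *: v].
Proof.
elim: s V => [|A s IHs] V Vlin Vnt cV sC sV; first by case: Vnt => v Vv v0; exists v.
have As : A \in A :: s by rewrite inE eqxx.
have ss B : B \in s -> B \in A :: s by rewrite inE => ->; rewrite orbT.
have [v [r [Vv v0 Av]]] := exists_eigenvector Vlin Vnt cV (fun v => sV A v As).
(* The eigenvalue equation is written entrywise to fit [vclosed_eq]. *)
have [] := IHs [set v | V v /\ forall i, (A *m v) i 0 = (r *: v) i 0].
- exact: linear_subspace_eigenspace.
- by exists v => //; split=> // i; rewrite Av.
- by apply: vclosed_eq => // i; [exact: vcont_mulmx|exact/vcont_scale/vcont_cst].
- by move=> B C sB sC'; apply: sC; exact: ss.
- move=> B z sB [Vz Az]; split=> [|i]; first by apply: sV => //; exact: ss.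
  rewrite mulmxA (sC A B As (ss B sB)) -mulmxA (_ : A *m z = r *: z) -?scalemxAr//.
  by apply/matrixP => k l; rewrite ord1.
move=> z [[Vz Az] z0 sz]; exists z; split=> // B; rewrite inE => /predU1P[->|/sz//].
by exists r; apply/matrixP => k l; rewrite ord1.
Qed.

Lemma commuting_positive_eigenvector (S : set 'M[K]_n) V :
  linear_subspace V -> nontrivial_subspace V -> vclosed V ->
  commutative_semigroup S -> leaves_invariant S V -> has_eigenvector S V.
Proof.
move=> Vlin Vnt cV SC SV.
(* On vectors of total 1 the eigenvalue must be [total (A *m v)], which makes
   "v is an eigenvector of A" a closed condition. *)
pose E A := [set v | (V v /\ forall i : unit, total v = 1) /\
  forall i, (A *m v) i 0 = (total (A *m v) *: v) i 0].
have E_eig A v r : V v -> total v = 1 -> A *m v = r *: v -> E A v.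
  by move=> Vv v1 Av; split=> // i; rewrite Av totalZ v1 mulr1.
have [v Ev] : \bigcap_(A in S) E A !=set0.
  apply: vclosed_finI => [A _|A v _ [[_ /(_ tt)]]//|D sD].
    apply: vclosed_eq => [|i|i]; last 2 first.
    - exact: vcont_mulmx.
    - exact/vcont_scale/vcont_total_mulmx.
    by apply: vclosed_eq => // _; [exact: vcont_total|exact: vcont_cst].
  have DS A : A \in finmap.enum_fset D -> S A by move=> AD; have := sD A AD; rewrite inE.
  have [] := @exists_eigenvector_seq (finmap.enum_fset D) V Vlin Vnt cV.
  - by move=> A B /DS SA /DS SB; exact: SC.
  - by move=> A v /DS SA; exact: SV.
  move=> v [Vv v0 eig]; have [c [_ Vcv cv1]] := normalize Vlin Vv v0.
  exists (c *: v) => A AD; have [r Av] := eig A AD; apply: (E_eig _ _ r) => //.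
  by rewrite -scalemxAr Av !scalerA mulrC.
(* Membership of [v] in [V] is read off from some [E A0]; for empty [S] any nonzero vector of [V]
   serves. *)
have [[A0 SA0]|S0] := pselect (exists A, S A); last first.
  by case: Vnt => z Vz z0; exists z; split=> // A SA; case: S0; exists A.
have [[Vv /(_ tt) v1] _] := Ev _ SA0.
exists v; split=> //; first exact: total1_neq0.
move=> A SA; have [_ Av] := Ev A SA; exists (total (A *m v)); apply/matrixP => i j; rewrite ord1.
exact: Av.
Qed.

End PositiveSemifield.

(** * The three cases of the theorem *)

Lemma nnval_surj (R : realType) (r : R) : 0 <= r -> exists x : nnreal R, nnval x = r.
Proof. by move=> r0; exists (NNReal r0). Qed.

Lemma nnval_ge0 (R : realType) (x : nnreal R) : 0 <= nnval x.
Proof. exact: nnvalP. Qed.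

Theorem theorem2p2 (R : realType) (n : nat) :
  (forall (V : set 'cV[Cplx R]_n) (S : set 'M[Cplx R]_n),
     linear_subspace V -> nontrivial_subspace V -> closed V ->
     op_semigroup S -> quasinilpotent_semigroup S \/ nilpotent_semigroup S ->
     leaves_invariant S V ->
     has_eigenvector S V)
  /\
  (forall (V : set 'cV[nnreal R]_n) (S : set 'M[nnreal R]_n),
     linear_subspace V -> nontrivial_subspace V -> closed_cone V ->
     op_semigroup S -> quasinilpotent_semigroup S \/ nilpotent_semigroup S ->
     leaves_invariant S V ->
     has_eigenvector S V)
  /\
  (forall (V : set 'cV[maxreal R]_n) (S : set 'M[maxreal R]_n),
     linear_subspace V -> nontrivial_subspace V -> closed_max_cone V ->
     op_semigroup S -> quasinilpotent_semigroup S \/ nilpotent_semigroup S ->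
     leaves_invariant S V ->
     has_eigenvector S V).
Proof.
have nn_inj : injective (@nnval R) by exact: val_inj.
split; [|split] => V S Vlin Vnt cV Ssg qS SV.
- apply: has_eigenvector_quasinilpotent => // [x /eqP x0|T TC TV].
    by exists x^-1; exact: mulVf.
  exact: (@commuting_eigenvector R[i]).
- have cD : continuous (fun p : R * R => p.1 + p.2) by exact: add_continuous.
  have Dge (a b : R) : 0 <= a -> 0 <= b -> a <= a + b by rewrite lerDl.
  have Dle (a b c : R) : a <= b -> a + c <= b + c by rewrite lerD2r.
  apply: has_eigenvector_quasinilpotent => //.
    exact: (exists_inv nn_inj (@nnval_ge0 R) (@nnval_surj R) (@nnvalM R)).
  move=> T; exact: (commuting_positive_eigenvector nn_inj (@nnval_ge0 R)
    (@nnval_surj R) (@nnvalM R) (@nnvalD R) cD Dge Dle).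
have cD : continuous (fun p : R * R => Num.max p.1 p.2) by exact: max_continuous.
have Dge (a b : R) : 0 <= a -> 0 <= b -> a <= Num.max a b by rewrite le_max lexx.
have Dle (a b c : R) : a <= b -> Num.max a c <= Num.max b c.
  by move=> ab; rewrite ge_max !le_max ab lexx orbT.
apply: has_eigenvector_quasinilpotent => //.
  exact: (@exists_inv R (maxreal R) _ nn_inj (@nnval_ge0 R) (@nnval_surj R) (@maxvalM R)).
move=> T; exact: (@commuting_positive_eigenvector R (maxreal R) _ _ nn_inj
  (@nnval_ge0 R) (@nnval_surj R) (@maxvalM R) (@maxvalD R) cD Dge Dle).
Qed.
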